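(* Let $n$ and $N$ be positive integers, let $\mathbb{F}\subset\mathbb{C}$ be a field, and let $p_1,\dots,p_n,q_1,\dots,q_n$ be positive integers such that (i) $p_1<\dots<p_n$; (ii) $p_i+q_i=N$ for all $i=1,\dots,n$; (iii) $p_i\neq q_j$ for all $i,j\in\{1,\dots,n\}$ with $i\neq j$. Let $f_1,\dots,f_n,g_1,\dots,g_n\colon\mathbb{F}\to\mathbb{C}$ be additive functions, none of them identically zero, each of which is a higher order derivation in the wide sense (a linear term is allowed; see the context), and suppose that \[ \sum_{i=1}^{n} f_i(x^{p_i})\,g_i(x)^{q_i}=0\qquad\text{for every }x\in\mathbb{F}. \] Suppose further that there are nonzero constants $c_1,\dots,c_n\in\mathbb{C}$ such that $g_i(x)=c_i\cdot f_i(x)$ for all $x\in\mathbb{F}$ and all $i\in\{1,\dots,n\}$. Then there are complex constants $\lambda_1,\dots,\lambda_n$ such that \[ f_i(x)=\lambda_i x\quad\text{and hence}\quad g_i(x)=c_i\lambda_i x\qquad(x\in\mathbb{F},\ i=1,\dots,n), \] and these constants fulfill $\displaystyle\sum_{i=1}^n c_i^{q_i}\lambda_i^{q_i+1}=0$.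
   Context: A function $f\colon\mathbb{F}\to\mathbb{C}$ is additive if $f(x+y)=f(x)+f(y)$ for all $x,y$. Let $\mathscr{D}_0(\mathbb{F})=\{0\}$; for $k\ge1$, $\mathscr{D}_k(\mathbb{F})$ (derivations of order $k$) is the set of additive functions $f\colon\mathbb{F}\to\mathbb{C}$ for which there is $B\colon\mathbb{F}\times\mathbb{F}\to\mathbb{C}$ that belongs to $\mathscr{D}_{k-1}(\mathbb{F})$ in each variable and satisfies $f(xy)-xf(y)-f(x)y=B(x,y)$ for all $x,y\in\mathbb{F}$. ''Higher order derivation in the wide sense'' means a function of the form $x\mapsto D(x)+\lambda x$ with $D\in\mathscr{D}_k(\mathbb{F})$ for some $k\geq 0$ and $\lambda\in\mathbb{C}$. *)

(* Defs.v *)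
From mathcomp Require Import all_boot all_order all_algebra.
From mathcomp Require Import reals.
From mathcomp Require Export complex.

Set Implicit Arguments.
Unset Strict Implicit.
Unset Printing Implicit Defensive.

Import GRing.Theory.
Local Open Scope ring_scope.

(* The complex numbers are [R[i]] with [R : realType].  A subfield of R[i] is
   a [F : subFieldType S]: a field whose elements are, through the ring
   morphism [val : F -> R[i]], exactly the complex numbers satisfying [S]. *)

Definition additive_map (R : realType) (S : pred R[i]) (F : subFieldType S)
    (f : F -> R[i]) : Prop :=
  forall x y : F, f (x + y) = f x + f y.

Fixpoint derivation_of_order (R : realType) (S : pred R[i])
    (F : subFieldType S) (k : nat) (f : F -> R[i]) : Prop :=
  match k with
  | 0 => forall x : F, f x = 0
  | k'.+1 =>
      additive_map f /\
      exists B : F -> F -> R[i],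
        [/\ forall y : F, derivation_of_order k' (fun x => B x y),
            forall x : F, derivation_of_order k' (fun y => B x y) &
            forall x y : F, f (x * y) - val x * f y - f x * val y = B x y]
  end.

Definition wide_higher_derivation (R : realType) (S : pred R[i])
    (F : subFieldType S) (f : F -> R[i]) : Prop :=
  exists (k : nat) (D : F -> R[i]) (lambda : R[i]),
    derivation_of_order k D /\ forall x : F, f x = D x + lambda * val x.

(* Main.v *)
(** For [a] in the domain put [delta_a h x = h (a x) - a h x]; a higher order
    derivation in the wide sense is killed by [delta_a^(k+1)] for some [k]
    and all [a], and it is linear when [k = 0].  Let [k >= 1] be minimal for
    the whole family [f_i].  Since [Z] is Zariski dense in [C], the functional
    equation persists on [F['X]] for the extensions [f_i (b 'X^j) = f_i b * a^j].
    Take [phi = (a - 'X)^k b]: then [f_i phi = delta_a^k f_i b], while [f_i]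
    vanishes on multiples of [phi^2] because [2k >= k+1].  The equation at
    [1 + m phi] therefore reads
      [sum_i c_i^q_i (f_i 1 + p_i m f_i phi) (f_i 1 + m f_i phi)^q_i = 0]
    for all [m], and as the [q_i] are distinct, the top power of [m] forces
    [f_i phi = 0] for all [i], which contradicts the minimality of [k]. *)
Require Import Defs.
From HB Require Import structures.
From mathcomp Require Import all_boot all_order all_algebra.
From mathcomp Require Import reals complex ring.

Set Implicit Arguments.
Unset Strict Implicit.
Unset Printing Implicit Defensive.

Import GRing.Theory.
Local Open Scope ring_scope.

Lemma poly_eq0_on_nat (K : numDomainType) (P : {poly K}) :
  (forall m : nat, P.[m%:R] = 0) -> P = 0.
Proof.
move=> P0; apply/eqP/negPn/negP => Pn0.
have /(_ [seq m%:R | m <- iota 0 (size P)]) := max_poly_roots Pn0.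
rewrite size_map size_iota ltnn => /(_ _ _)/negP; apply => //.
- by apply/allP => _ /mapP[m _ ->]; apply/rootP.
- rewrite map_inj_uniq ?iota_uniq // => m m' /eqP.
  by rewrite Num.Theory.eqr_nat => /eqP.
Qed.

Lemma exprD1_trunc (A : comNzRingType) (y : A) (p : nat) :
  exists r, (1 + y) ^+ p = 1 + y *+ p + y ^+ 2 * r.
Proof.
elim: p => [|p [r IH]]; first by exists 0; rewrite mulr0 !addr0.
exists (p%:R + r * (1 + y)).
by rewrite exprSr IH; ring.
Qed.

Lemma coef_linear_mul (K : comNzRingType) (e a : K) (P : {poly K}) (j : nat) :
  ((e%:P + a *: 'X) * P)`_j.+1 = e * P`_j.+1 + a * P`_j.
Proof. by rewrite mulrDl coefD coefCM -scalerAl coefZ coefXM. Qed.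

Lemma coef_linear_exp_gt (K : comNzRingType) (e a : K) (m j : nat) :
  (m < j)%N -> ((e%:P + a *: 'X) ^+ m)`_j = 0.
Proof.
elim: m j => [|m IH] [|j] // mj; first by rewrite expr0 coef1.
by rewrite exprS coef_linear_mul !IH ?mulr0 ?addr0 // ltnW.
Qed.

Lemma coef_linear_exp (K : comNzRingType) (e a : K) (m : nat) :
  ((e%:P + a *: 'X) ^+ m)`_m = a ^+ m.
Proof.
elim: m => [|m IH]; first by rewrite !expr0 coef1.
by rewrite exprS coef_linear_mul IH coef_linear_exp_gt // mulr0 add0r exprS.
Qed.

(** Among the indices with nonzero slope take [i] with [q i] maximal. In the sum, read as a
    polynomial in [m], the coefficient of degree [q i + 1] comes from [i] alone: zero slopes give
    constants, the other slopes a smaller degree. It equals [w i * p i * a i ^+ (q i).+1], nonzero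
    in characteristic 0. *)
Lemma sum_linear_exp_slopes_eq0 (K : numDomainType) (n : nat) (p q : 'I_n -> nat)
    (w e a : 'I_n -> K) :
  (forall i, (0 < p i)%N) -> injective q -> (forall i, w i != 0) ->
  (forall m : nat,
     \sum_(i < n) w i * (e i + a i *+ p i * m%:R) * (e i + a i * m%:R) ^+ q i = 0) ->
  forall i, a i = 0.
Proof.
move=> p_gt0 q_inj w_neq0 sum0 i0; apply/eqP/negPn/negP => ai0.
case: (@arg_maxnP _ i0 (fun i => a i != 0) q ai0) => i ai_neq0 q_max.
pose P k := ((e k)%:P + a k *+ p k *: 'X) * ((e k)%:P + a k *: 'X) ^+ q k.
have : (\sum_k w k *: P k)`_(q i).+1 = 0.
  rewrite (_ : \sum_k _ = 0) ?coef0 //; apply: poly_eq0_on_nat => m.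
  rewrite horner_sum -[RHS](sum0 m); apply: eq_bigr => k _.
  by rewrite /P !(hornerE, horner_exp).
rewrite coef_sum (bigD1 i) //= big1 => [|k k_neq_i].
  rewrite addr0 coefZ coef_linear_mul coef_linear_exp_gt // coef_linear_exp mulr0 add0r.
  apply/eqP; rewrite !mulf_neq0 ?expf_neq0 //.
  by rewrite -mulr_natr mulf_neq0 // Num.Theory.pnatr_eq0 -lt0n.
rewrite coefZ /P; have [ak0|ak_neq0] := eqVneq (a k) 0.
  by rewrite ak0 mul0rn !scale0r !addr0 -exprS -rmorphXn coefC mulr0.
have qk_lt : (q k < q i)%N.
  by rewrite ltn_neqAle (inj_eq q_inj) k_neq_i; apply: q_max.
by rewrite coef_linear_mul !coef_linear_exp_gt ?mulr0 ?addr0 ?mulr0 // ltnW.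
Qed.

Section Delta.
Variables (A : comNzRingType) (K : numDomainType) (eps : {rmorphism A -> K}).
Implicit Types (f : {additive A -> K}) (a b : A) (P Q : {poly A}).

(** The commutator of [f] with multiplication by [a], where [A] acts on [K] through [eps]. *)
Definition delta a (f : A -> K) (x : A) : K := f (a * x) - eps a * f x.

Fact delta_is_zmod_morphism a f : zmod_morphism (delta a f).
Proof.
by move=> x y; rewrite /delta mulrBr !raddfB mulrBr /=; ring.
Qed.

HB.instance Definition _ a f :=
  GRing.isZmodMorphism.Build A K (delta a f) (delta_is_zmod_morphism a f).

Lemma map_poly_nat f P (m : nat) : (map_poly f P).[m%:R] = f P.[m%:R].
Proof.
have szP : (size (map_poly f P) <= size P)%N by apply: size_poly.
rewrite (horner_coef_wide _ szP) horner_coef raddf_sum.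
by apply: eq_bigr => j _; rewrite coef_map -!natrX !mulr_natr raddfMn.
Qed.

Lemma map_poly_XsubC f a k P :
  (map_poly f ((a%:P - 'X) ^+ k * P)).[eps a] =
  (map_poly (iter k (delta a) f) P).[eps a].
Proof.
elim: k f => [|k IH] f; first by rewrite expr0 mul1r.
rewrite iterSr -[delta a f]/(GRing.Additive.sort _) -IH exprS -mulrA.
move: (_ * P) => Q.
(* The last two terms cancel on evaluation at [eps a]. *)
have -> : map_poly f ((a%:P - 'X) * Q)
    = map_poly (delta a f) Q + eps a *: map_poly f Q - 'X * map_poly f Q.
  apply/polyP => j; rewrite mulrBl !(coefB, coefD, coefZ, coef_map, coefCM, coefXM).
  rewrite raddfB.
  by rewrite /= /delta subrK coefN coefXM coef_map; case: j => [|j] /=; rewrite ?raddf0.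
by rewrite !hornerE addrK.
Qed.

(** At [z = m] natural, additivity turns the left side into the hypothesis at [x = P.[m%:R]]; a
    polynomial in [z] vanishing at all naturals is zero. *)
Lemma map_poly_identity n (p q : 'I_n -> nat) (w : 'I_n -> K)
    (f : 'I_n -> {additive A -> K}) (z : K) P :
  (forall x, \sum_(i < n) w i * f i (x ^+ p i) * f i x ^+ q i = 0) ->
  \sum_(i < n) w i * (map_poly (f i) (P ^+ p i)).[z]
               * (map_poly (f i) P).[z] ^+ q i = 0.
Proof.
move=> fE.
pose G := \sum_(i < n) w i *: map_poly (f i) (P ^+ p i) * map_poly (f i) P ^+ q i.
have GE y : G.[y] = \sum_(i < n) w i * (map_poly (f i) (P ^+ p i)).[y]
    * (map_poly (f i) P).[y] ^+ q i.
  by rewrite horner_sum; apply: eq_bigr => i _; rewrite !(hornerE, horner_exp).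
rewrite -GE (_ : G = 0) ?horner0 //; apply: poly_eq0_on_nat => m.
rewrite GE -[RHS](fE P.[m%:R]); apply: eq_bigr => i _.
by rewrite !map_poly_nat horner_exp.
Qed.

Lemma delta_order_descent n (p q : 'I_n -> nat) (w : 'I_n -> K)
    (f : 'I_n -> {additive A -> K}) (k : nat) :
  (forall i, (0 < p i)%N) -> injective q -> (forall i, w i != 0) ->
  (forall x, \sum_(i < n) w i * f i (x ^+ p i) * f i x ^+ q i = 0) ->
  (forall i a, iter k.+2 (delta a) (f i) =1 (fun=> 0)) ->
  forall i a, iter k.+1 (delta a) (f i) =1 (fun=> 0).
Proof.
move=> p_gt0 q_inj w_neq0 fE f0 i a b.
pose phi : {poly A} := (a%:P - 'X) ^+ k.+1 * b%:P.
pose ev j P := (map_poly (f j) P).[eps a].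
have evD j P Q : ev j (P + Q) = ev j P + ev j Q by rewrite /ev raddfD hornerD.
have evMn j P m : ev j (P *+ m) = ev j P *+ m by rewrite /ev raddfMn hornerMn.
have ev_phi j : ev j phi = iter k.+1 (delta a) (f j) b.
  have d0 : iter k.+1 (delta a) (f j) 0 = 0.
    by elim: k.+1 => [|l IH] /=; rewrite ?raddf0 // /delta mulr0 IH mulr0 subr0.
  have map_b : map_poly (iter k.+1 (delta a) (f j)) b%:P
      = (iter k.+1 (delta a) (f j) b)%:P.
    by apply/polyP => l; rewrite coef_map_id0 // !coefC; case: ifP.
  by rewrite /ev map_poly_XsubC map_b hornerC.
(* Since 2(k+1) = (k+2) + k, the square contains enough factors [a - 'X] for [k.+2] iterates of
   [delta a], which kill [f j]. *)
have ev_phi2 j P : ev j (phi ^+ 2 * P) = 0.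
  have -> : phi ^+ 2 * P
      = (a%:P - 'X) ^+ k.+2 * ((a%:P - 'X) ^+ k * b%:P ^+ 2 * P).
    by rewrite /phi !exprS; ring.
  rewrite /ev map_poly_XsubC (_ : map_poly _ _ = 0) ?horner0 //.
  by apply/polyP => l; rewrite coef_map_id0 ?f0 // coef0.
rewrite -ev_phi.
apply: (sum_linear_exp_slopes_eq0 (a := fun j => ev j phi) (e := fun j => ev j 1)
  p_gt0 q_inj w_neq0) => m.
rewrite -[RHS](map_poly_identity (eps a) (1 + phi *+ m) fE); apply: eq_bigr => j _.
rewrite -![(map_poly _ _).[_]]/(ev j _).
(* Modulo [phi ^+ 2] the power is [1 + p j * m * phi], so its value is affine in [m]. *)
have [r ->] := exprD1_trunc (phi *+ m) (p j).
have -> : (phi *+ m) ^+ 2 * r = phi ^+ 2 * (r *+ m ^ 2).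
  by rewrite exprMn_n mulrnAl mulrnAr.
by rewrite !evD ev_phi2 addr0 !evMn !mulr_natr mulrnAC.
Qed.

Lemma delta_eq0 n (p q : 'I_n -> nat) (w : 'I_n -> K)
    (f : 'I_n -> {additive A -> K}) (k : nat) :
  (forall i, (0 < p i)%N) -> injective q -> (forall i, w i != 0) ->
  (forall x, \sum_(i < n) w i * f i (x ^+ p i) * f i x ^+ q i = 0) ->
  (forall i a, iter k.+1 (delta a) (f i) =1 (fun=> 0)) ->
  forall i a, delta a (f i) =1 (fun=> 0).
Proof.
move=> p_gt0 q_inj w_neq0 fE; elim: k => [//|k IH] f0; apply: IH.
exact: delta_order_descent fE f0.
Qed.

Lemma iter_deltaD a (f g : A -> K) (k : nat) (x : A) :
  iter k (delta a) (fun y => f y + g y) x = iter k (delta a) f x + iter k (delta a) g x.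
Proof.
elim: k x => //= k IH x; rewrite /delta !IH; ring.
Qed.

Lemma eq_iter_delta a (f g : A -> K) (k : nat) :
  f =1 g -> iter k (delta a) f =1 iter k (delta a) g.
Proof. by move=> fg; elim: k => //= k IH x; rewrite /delta !IH. Qed.

Lemma iter_delta_scale a (c : K) (k : nat) (x : A) :
  iter k.+1 (delta a) (fun y => c * eps y) x = 0.
Proof.
elim: k x => [|k IH] x; first by rewrite /= /delta rmorphM; ring.
by rewrite iterS /delta !IH mulr0 subr0.
Qed.

End Delta.

(** One [delta] turns [D] into [B a], of order one less, plus a multiple of [val], which the next
    [delta] kills. Allowing every [l > k] lets derivations of different orders share one
    exponent. *)
Lemma derivation_iter_delta (R : realType) (S : pred R[i]) (F : subFieldType S)
    (k : nat) (D : F -> R[i]) (a : F) :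
  derivation_of_order k D ->
  forall l, (k < l)%N -> iter l (delta (val : {rmorphism F -> R[i]}) a) D =1 (fun=> 0).
Proof.
elim: k D => [|k IH] D.
  move=> D0 l _; elim: l => [|l IHl] x /=; first exact: D0.
  by rewrite /delta !IHl mulr0 subr0.
move=> [_ [B [_ BD DB]]] [//|l] kl x.
have dD y : delta (val : {rmorphism F -> R[i]}) a D y = B a y + D a * val y.
  by rewrite /delta -DB /=; ring.
rewrite iterSr (eq_iter_delta _ _ _ dD) iter_deltaD (IH _ (BD a)) // add0r.
by case: l kl => // l _; rewrite iter_delta_scale.
Qed.

Theorem corollary3 (R : realType) (n N : nat) (hn : (0 < n)%N) (hN : (0 < N)%N)
  (S : pred R[i]) (F : subFieldType S)
  (p q : 'I_n -> nat)
  (hp0 : forall i, (0 < p i)%N) (hq0 : forall i, (0 < q i)%N)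
  (hp : forall i j : 'I_n, (i < j)%N -> (p i < p j)%N)
  (hpq : forall i, (p i + q i)%N = N)
  (hneq : forall i j : 'I_n, i <> j -> p i <> q j)
  (f g : 'I_n -> F -> R[i])
  (hf : forall i, additive_map (f i)) (hg : forall i, additive_map (g i))
  (hf0 : forall i, exists x, f i x <> 0) (hg0 : forall i, exists x, g i x <> 0)
  (hfD : forall i, wide_higher_derivation (f i))
  (hgD : forall i, wide_higher_derivation (g i))
  (hsum : forall x : F, \sum_(i < n) f i (x ^+ p i) * g i x ^+ q i = 0)
  (c : 'I_n -> R[i]) (hc : forall i, c i <> 0)
  (hgf : forall i (x : F), g i x = c i * f i x) :
  exists lambda : 'I_n -> R[i],
    [/\ forall i (x : F), f i x = lambda i * val x,
        forall i (x : F), g i x = c i * lambda i * val x &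
        \sum_(i < n) c i ^+ q i * lambda i ^+ (q i).+1 = 0].
Proof.
pose eps : {rmorphism F -> R[i]} := val.
have f_zmod i : zmod_morphism (f i).
  have f0 : f i 0 = 0 by apply: (addrI (f i 0)); rewrite -(hf i) !addr0.
  have fN x : f i (- x) = - f i x.
    by apply/eqP; rewrite -addr_eq0 -(hf i) addNr f0.
  by move=> x y; rewrite (hf i) fN.
pose fa i : {additive F -> R[i]} :=
  HB.pack (f i) (GRing.isZmodMorphism.Build _ _ (f i) (f_zmod i)).
(* [p] is strictly increasing and [q i = N - p i]. *)
have q_inj : injective q.
  have p_inj : injective p.
    move=> i j pij; apply/val_inj/eqP; rewrite eqn_leq leqNgt [(j <= i)%N]leqNgt.
    by apply/andP; split; apply/negP => /hp; rewrite pij ltnn.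
  move=> i j qij; apply: p_inj; apply: (@addIn (q i)).
  by rewrite hpq qij hpq.
have w_neq0 i : c i ^+ q i != 0 by apply/expf_neq0/eqP/hc.
have fE x : \sum_(i < n) c i ^+ q i * fa i (x ^+ p i) * fa i x ^+ q i = 0.
  rewrite -[RHS](hsum x); apply: eq_bigr => i _ /=.
  by rewrite hgf exprMn mulrA [_ * f i _]mulrC.
have [k f_order] : exists k, forall i a,
    iter k.+1 (delta eps a) (fa i) =1 (fun=> 0).
  have ex_k i : exists k, forall a l, (k < l)%N ->
      iter l (delta eps a) (fa i) =1 (fun=> 0).
    have [k [D [lam [Dk fD]]]] := hfD i; exists k => a [//|l] kl x.
    rewrite (eq_iter_delta _ _ _ fD) iter_deltaD iter_delta_scale addr0.
    exact: derivation_iter_delta Dk _ kl x.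
  have [k kP] := fin_all_exists ex_k.
  (* The largest of the finitely many orders serves all [f i]. *)
  exists (\max_i k i)%N => i a; apply: kP; rewrite ltnS; exact: leq_bigmax.
(* This is the vanishing of [delta eps x (f i)] at 1. *)
have f_lin i x : f i x = f i 1 * val x.
  have := delta_eq0 hp0 q_inj w_neq0 fE f_order i x 1.
  by rewrite /delta /= mulr1 => /eqP; rewrite subr_eq0 mulrC => /eqP.
exists (fun i => f i 1); split => // [i x|]; first by rewrite hgf f_lin mulrA.
(* The relation between the constants is the equation at [x = 1]. *)
rewrite -[RHS](fE 1); apply: eq_bigr => i _.
by rewrite expr1n exprS mulrA.
Qed.
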